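(* Let $G$ be a finite simple graph of order at least $7$. If $G$ is $2$-connected and $G$ is a $[4,2]$-graph, then $G$ is pancyclic.
   Context: For integers $s,t$, a graph $G$ is called an $[s,t]$-graph if every induced subgraph of $G$ on $s$ vertices has at least $t$ edges. A graph $G$ of order $n$ is pancyclic if for every integer $k$ with $3\le k\le n$, $G$ contains a cycle of length $k$. *)

(* Defs.v *)
From mathcomp Require Import all_boot.
Set Implicit Arguments. Unset Strict Implicit. Unset Printing Implicit Defensive.

Definition simple_graph (T : finType) (e : rel T) : Prop :=
  symmetric e /\ irreflexive e.

Definition edges_in (T : finType) (e : rel T) (S : {set T}) : {set {set T}} :=
  [set E : {set T} | (E \subset S) && (#|E| == 2) &&
     [forall x in E, forall y in E, (x != y) ==> e x y]].

Definition st_graph (T : finType) (e : rel T) (s t : nat) : Prop :=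
  forall S : {set T}, #|S| = s -> t <= #|edges_in e S|.

Definition connected_graph (T : finType) (e : rel T) : Prop :=
  forall x y : T, connect e x y.

Definition connected_minus (T : finType) (e : rel T) (v : T) : Prop :=
  forall x y : T, x != v -> y != v ->
    connect [rel a b | e a b && (a != v) && (b != v)] x y.

Definition two_connected (T : finType) (e : rel T) : Prop :=
  2 < #|T| /\ connected_graph e /\ forall v : T, connected_minus e v.

(* A cycle of length k: k distinct vertices v_1..v_k, consecutive ones
   adjacent, and v_k adjacent to v_1 (path.cycle includes the closing edge). *)
Definition has_cycle_of_length (T : finType) (e : rel T) (k : nat) : Prop :=
  exists s : seq T, [/\ size s = k, uniq s & cycle e s].

Definition pancyclic (T : finType) (e : rel T) : Prop :=
  forall k : nat, 3 <= k <= #|T| -> has_cycle_of_length e k.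

(* Main.v *)
Require Import Defs.
From mathcomp Require Import all_boot.
From mathcomp Require Import zify.
Set Implicit Arguments. Unset Strict Implicit. Unset Printing Implicit Defensive.

(* In a [4,2]-graph every vertex outside an independent triple is adjacent to
   at least two of its members.

   Hamiltonicity: a longest cycle u A v B missing some vertex has an ear P from
   u to v, by 2-connectivity. With a, c the successors of u, v on the cycle and
   p in P, the triple {p, a, c} is independent, which forces P = {p} and no
   further vertex outside the cycle. A vertex x of A other than a is not
   adjacent to p, since otherwise its successor would extend the triple to four
   independent vertices; hence x is adjacent to a and c. If A or B has at least
   three vertices, or both have two, these edges give a Hamiltonian cycle.

   Descent from length k + 1 to k >= 3: a chord joining vertices at distance 2
   shortens the cycle by one, so assume there is none. If v1v5, v2v6, v3v7 are
   edges, then v1 v5 v6 v2 v3 v7 v8 ... omits v4. Otherwise, up to rotation,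
   {v1, v3, v5} is independent; when k >= 7 there are consecutive x, y after v5
   with x adjacent to v3 and y to v5, and v5 ... x v3 v2 v1 ... y omits v4.
   Lengths up to 7 are finite case analyses; up to 6 they also use one, two or
   three vertices outside the cycle. *)

(** * Counting and splitting in sequences *)

(** Quantifying over all predicates makes the premise survive concatenation and reversal:
    [count_tac] turns it into linear arithmetic over opaque counts of the pieces. *)
Lemma leq_count_uniq (T : eqType) (s1 s2 : seq T) :
  (forall q : pred T, count q s1 <= count q s2) -> uniq s2 -> uniq s1.
Proof.
move=> le12 Us2; have: forall x, count_mem x s1 <= 1.
  by move=> x; rewrite (leq_trans (le12 _)) // count_uniq_mem // leq_b1.
elim: s1 {le12} => //= y s IH le1; rewrite IH ?andbT => [|x].
  by have:= le1 y; rewrite eqxx add1n ltnS leqn0 => /eqP/count_memPn.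
exact: leq_trans (leq_addl _ _) (le1 x).
Qed.

Ltac count_tac :=
  move=> ?; rewrite -?cats1 /= ?(count_cat, count_rev) /=
                    ?(count_cat, count_rev) /= ?(count_cat, count_rev) /=; clear;
  repeat match goal with
  | |- context [nat_of_bool ?b] => move: (nat_of_bool b) => ?
  | |- context [count ?q ?l] => move: (count q l) => ?
  end; lia.

Ltac size_tac :=
  rewrite -?cats1 /= ?(size_cat, size_rev) /= ?(size_cat, size_rev) /=
          ?(size_cat, size_rev) /=; clear; lia.

Lemma first_switch (T : Type) (p : pred T) x L :
  ~~ p x -> p (last x L) ->
  exists L1 a b L2, [/\ x :: L = L1 ++ a :: b :: L2, ~~ p a & p b].
Proof.
elim: L x => [x /negbTE->|y L IH x nx pl] //.
have [py|ny] := boolP (p y); first by exists [::], x, y, L.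
have [L1 [a [b [L2 [-> na pb]]]]] := IH y ny pl.
by exists (x :: L1), a, b, L2.
Qed.

Lemma mem_split (T : eqType) (x : T) s :
  x \in s -> exists s1 s2, s = s1 ++ x :: s2.
Proof. by case/splitPr => s1 s2; exists s1, s2. Qed.

(** * Paths and independent triples *)

Section Graph.
Variables (T : finType) (e : rel T).
Hypothesis (esym : symmetric e) (eirr : irreflexive e).

Lemma e_neq x y : e x y -> x != y.
Proof. by apply: contraTneq => ->; rewrite eirr. Qed.

(* [path e x (rcons L y)] encodes a path from x to y with interior L; in this
   form paths concatenate at an explicit vertex and reverse without casts. *)
Lemma link_cat x L y M z :
  path e x (rcons (L ++ y :: M) z) =
  path e x (rcons L y) && path e y (rcons M z).
Proof. by rewrite rcons_cat cat_path /= (rcons_path _ _ L) andbA. Qed.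

Lemma link_rev x L y : path e x (rcons (rev L) y) = path e y (rcons L x).
Proof.
have := rev_path e y (rcons L x).
rewrite last_rcons belast_rcons rev_cons => ->.
by apply: eq_path => a b; rewrite esym.
Qed.

Lemma st_graph_edges a b c d : st_graph e 4 2 -> uniq [:: a; b; c; d] ->
  2 <= e a b + e a c + e a d + e b c + e b d + e c d.
Proof.
move=> st U; have card4 : #|[set x in [:: a; b; c; d]]| = 4.
  by rewrite cardsE; move/card_uniqP: U => ->.
apply: leq_trans (st _ card4) _.
(* [L] lists those of the six pairs that are edges; it covers [edges_in], and its size is the
   sum. *)
pose L := nseq (e a b) [set a; b] ++ nseq (e a c) [set a; c]
  ++ nseq (e a d) [set a; d] ++ nseq (e b c) [set b; c]
  ++ nseq (e b d) [set b; d] ++ nseq (e c d) [set c; d].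
have -> : e a b + e a c + e a d + e b c + e b d + e c d = size L.
  by rewrite !size_cat !size_nseq !addnA.
apply: leq_trans (card_size L); apply/subset_leq_card/subsetP => E.
rewrite inE -andbA => /and3P[sE /cards2P[x [y [nxy EE]]] /forall_inP adj].
have [xE yE] : x \in E /\ y \in E by rewrite EE !inE !eqxx orbT.
have exy : e x y by have /forall_inP/(_ y yE) := adj x xE; rewrite nxy.
have {sE}[] := (subsetP sE x xE, subsetP sE y yE); rewrite !inE EE.
rewrite /L !mem_cat !mem_nseq.
by case/or4P=> /eqP xD /or4P[] /eqP yD; move: exy nxy; rewrite xD yD ?eqxx // => exy _;
  rewrite ?exy ?eqxx ?orbT // setUC; move: exy; rewrite esym => ->;
  rewrite eqxx ?orbT.
Qed.

Hypothesis st : st_graph e 4 2.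

(** Only [d b] and [d c] remain as possible edges among the four vertices, so both are present. *)
Lemma indep3_nbrs a b c d : uniq [:: a; b; c; d] ->
  ~~ e a b -> ~~ e a c -> ~~ e b c -> ~~ e d a -> e d b && e d c.
Proof.
move=> U /negbTE ab /negbTE ac /negbTE bc; rewrite esym => /negbTE ad.
have := st_graph_edges st U; rewrite ab ac bc ad ![e d _]esym.
by case: (e b d) (e c d) => [] [].
Qed.

(** * Shortening long cycles by one vertex *)

Lemma has_cycle_sub k s S : size s = k -> uniq S -> cycle e s ->
  (forall q : pred T, count q s <= count q S) -> has_cycle_of_length e k.
Proof. by move=> sz US cs /leq_count_uniq Us; exists s; split=> //; exact: Us. Qed.


Lemma cycle_chord k x y z R : size (x :: y :: z :: R) = k.+1 ->
  uniq (x :: y :: z :: R) -> cycle e (x :: y :: z :: R) -> e x z ->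
  has_cycle_of_length e k.
Proof.
move=> [sz] U /and3P[_ _ pR] xz.
apply: (has_cycle_sub (s := x :: z :: R) _ U) => //=; first by rewrite xz.
by count_tac.
Qed.

Lemma cycle_minus_fourth k v1 v2 v3 v4 v5 v6 v7 R
    (s := [:: v1, v2, v3, v4, v5, v6, v7 & R]) :
  size s = k.+1 -> uniq s -> cycle e s -> e v1 v5 -> e v2 v6 -> e v3 v7 ->
  has_cycle_of_length e k.
Proof.
rewrite {}/s => -[sz] U /= cs e15 e26 e37.
case/and5P: cs => _ e23 _ _ /and3P[e56 _ cR].
apply: (has_cycle_sub (s := [:: v1, v5, v6, v2, v3, v7 & R]) _ U) => //=.
  by rewrite e15 e56 (esym v6) e26 e23 e37.
count_tac.
Qed.

Lemma cycle_nonchord5 k v1 v2 v3 v4 v5 R (s := [:: v1, v2, v3, v4, v5 & R]) :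
  size s = k.+1 -> uniq s -> cycle e s -> 7 <= k -> ~~ e v1 v5 ->
  has_cycle_of_length e k.
Proof.
rewrite {}/s; move=> sz U cs k7 n15.
have [e13|n13] := boolP (e v1 v3); first by apply: cycle_chord cs e13.
have [e35|n35] := boolP (e v3 v5).
  apply: (@cycle_chord k v3 v4 v5 (R ++ [:: v1; v2])) => //.
  - by rewrite -sz /= size_cat /=; lia.
  - by apply: leq_count_uniq U; count_tac.
  - by move: cs; rewrite -(rot_cycle 2).
case: R => [|v6 [|v7 R]] in sz U cs *; try by move: sz k7 => /=; lia.
case/lastP: R => [|M z] in sz U cs *; first by move: sz k7 => /=; lia.
have [e57|n57] := boolP (e v5 v7).
  apply: (@cycle_chord k v5 v6 v7 (rcons M z ++ [:: v1; v2; v3; v4])) => //.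
  - by rewrite -sz /= !size_cat /=; lia.
  - by apply: leq_count_uniq U; count_tac.
  - by move: cs; rewrite -(rot_cycle 4).
(* [w] lies two steps before [v1] and may equal [v7]. Lacking a chord to [v1], it is adjacent to
   [v5], while [v7] is not; so adjacency to [v5] switches on between [v7] and [w]. *)
have [w [M' defM]] : exists w M', v7 :: M = rcons M' w.
  by case/lastP: M => [|M' w] in sz U cs *; [exists v7, [::] | exists w, (v7 :: M')].
have defR : v7 :: rcons M z = rcons (rcons M' w) z by rewrite -defM.
have [e1w|n1w] := boolP (e v1 w).
  apply: (@cycle_chord k w z v1 ([:: v2; v3; v4; v5; v6] ++ M')).
  - by move: sz; rewrite defR /= !size_rcons /=; lia.
  - by apply: leq_count_uniq U; rewrite defR; count_tac.
  - have <- : rot (size ([:: v1; v2; v3; v4; v5; v6] ++ M'))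
        ([:: v1, v2, v3, v4, v5, v6 & rcons (rcons M' w) z]) =
        [:: w, z, v1 & [:: v2; v3; v4; v5; v6] ++ M'].
      rewrite -!cats1 -catA.
      exact: (rot_size_cat ([:: v1; v2; v3; v4; v5; v6] ++ M') [:: w; z]).
    by rewrite rot_cycle -defR.
  - by rewrite esym.
have nbr x : x \in v6 :: v7 :: rcons M z -> ~~ e x v5 -> e x v3.
  move=> xR nx5; suff: e x v1 && e x v3 by case/andP.
  apply: (@indep3_nbrs v5); rewrite ?(esym v5) //.
  have [L1 [L2 defL]] := mem_split xR.
  by apply: leq_count_uniq U; rewrite defL; count_tac.
have wR : w \in v6 :: v7 :: rcons M z.
  by rewrite in_cons defR !(mem_rcons, in_cons) eqxx !orbT.
have e5w : e w v5.
  have := @indep3_nbrs v1 v3 v5 w; rewrite n13 n15 n35 (esym w v1) n1w.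
  case/(_ _ isT isT isT isT)/andP => //.
  have [L1 [L2 defL]] := mem_split wR.
  by apply: leq_count_uniq U; rewrite defL; count_tac.
have [||L1 [a [b [L2 [defL na5 eb5]]]]] := @first_switch _ (e^~ v5) v7 M.
- by rewrite esym.
- by rewrite -(last_cons w) defM last_rcons.
have e3a : e a v3.
  by apply: nbr na5; rewrite -rcons_cons defL !(mem_rcons, in_cons, mem_cat) eqxx !orbT.
rewrite -rcons_cons defL in sz U cs.
apply: (has_cycle_sub (s := v5 :: v6 :: L1 ++ a :: v3 :: v2 :: v1 :: rev (b :: rcons L2 z)) _ U).
- by move: sz; size_tac.
- move: cs => /= /and5P[e12 e23 _ _ /andP[e56]].
  rewrite rcons_cat !rcons_cons link_cat => /andP[pL1 /= /andP[_ pL2]].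
  rewrite /= link_cat e56 pL1 /= link_rev /= pL2.
  by rewrite e3a (esym v3) e23 (esym v2) e12 (esym v5) eb5.
count_tac.
Qed.

(** * Shortening cycles of length at most 7 *)

Ltac edges_tac := rewrite /= ?andbT;
  repeat (apply/andP; split); by [|rewrite esym].
Ltac uniq_tac U := by apply: leq_count_uniq U; count_tac.
Ltac cycle_tac U L := apply: (has_cycle_sub (s := L) _ U); [by []|edges_tac|count_tac].
(** An edge [x y] would close the cycle [L] and the goal, so the argument continues with a
    non-edge. *)
Ltac nonchord_tac U x y L H :=
  have [H|H] := boolP (e x y); [by cycle_tac U L|].
Ltac nbrs_tac U a b c d H1 H2 :=
  have /andP[H1 H2] : e d b && e d c by
    apply: (@indep3_nbrs a); [uniq_tac U|edges_tac|edges_tac|edges_tac|edges_tac].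

(** Without chords at distance 2, the triple [v1], [v3], [v5] is independent and makes [v3] adjacent
    to [v6] and [v7]. The pairs [v2 v6] and [v4 v7] decide which 6-cycle exists. *)
Lemma cycle7_nonchord5 v1 v2 v3 v4 v5 v6 v7
    (s := [:: v1; v2; v3; v4; v5; v6; v7]) :
  uniq s -> cycle e s -> ~~ e v1 v5 -> has_cycle_of_length e 6.
Proof.
rewrite {}/s => U /= /and5P[e12 e23 e34 e45 /and4P[e56 e67 e71 _]] n15.
nonchord_tac U v1 v3 [:: v1; v3; v4; v5; v6; v7] n13.
nonchord_tac U v2 v4 [:: v1; v2; v4; v5; v6; v7] n24.
nonchord_tac U v3 v5 [:: v1; v2; v3; v5; v6; v7] n35.
nonchord_tac U v4 v6 [:: v1; v2; v3; v4; v6; v7] n46.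
nonchord_tac U v5 v7 [:: v1; v2; v3; v4; v5; v7] n57.
nonchord_tac U v6 v1 [:: v1; v2; v3; v4; v5; v6] n61.
nonchord_tac U v7 v2 [:: v7; v2; v3; v4; v5; v6] n72.
nbrs_tac U v5 v1 v3 v7 e71' e73.
nbrs_tac U v1 v3 v5 v6 e63 e65.
have [e26|n26] := boolP (e v2 v6); last first.
  nbrs_tac U v6 v2 v4 v1 e12' e14.
  nbrs_tac U v2 v4 v6 v7 e74 e76.
  by cycle_tac U [:: v1; v2; v3; v6; v7; v4].
have [e47|n47] := boolP (e v4 v7).
  by cycle_tac U [:: v1; v2; v6; v3; v4; v7].
nbrs_tac U v7 v2 v4 v5 e52 e54.
by cycle_tac U [:: v1; v2; v5; v6; v3; v7].
Qed.

(** Without chords at distance 2, both alternating triples are independent, so [w] has two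
    neighbours in each. Hence it has two opposite neighbours, and half of the hexagon closes up
    through [w]. *)
Lemma cycle6_shorten w v1 v2 v3 v4 v5 v6 (s := [:: v1; v2; v3; v4; v5; v6]) :
  uniq (w :: s) -> cycle e s -> has_cycle_of_length e 5.
Proof.
rewrite {}/s => U /= /and5P[e12 e23 e34 e45 /and3P[e56 e61 _]].
nonchord_tac U v1 v3 [:: v1; v3; v4; v5; v6] n13.
nonchord_tac U v2 v4 [:: v1; v2; v4; v5; v6] n24.
nonchord_tac U v3 v5 [:: v1; v2; v3; v5; v6] n35.
nonchord_tac U v4 v6 [:: v1; v2; v3; v4; v6] n46.
nonchord_tac U v5 v1 [:: v1; v2; v3; v4; v5] n51.
nonchord_tac U v6 v2 [:: v2; v3; v4; v5; v6] n62.
have [w1|w1] := boolP (e w v1).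
  nonchord_tac U w v4 [:: w; v1; v2; v3; v4] w4.
  nbrs_tac U v4 v2 v6 w w2 w6.
  nonchord_tac U w v5 [:: w; v2; v3; v4; v5] w5.
  nbrs_tac U v5 v1 v3 w w1' w3.
  by cycle_tac U [:: w; v3; v4; v5; v6].
nbrs_tac U v1 v3 v5 w w3 w5.
nonchord_tac U w v6 [:: w; v3; v4; v5; v6] w6.
nbrs_tac U v6 v2 v4 w w2 w4.
by cycle_tac U [:: w; v2; v3; v4; v5].
Qed.

(** Unless a chord helps, [w], [v3], [v5] are independent, so [w] is adjacent to [v1] and [v2]. Any
    two neighbours of [u] in the triple then give a 4-cycle. *)
Lemma cycle5_nonnbrs u w v1 v2 v3 v4 v5 (s := [:: v1; v2; v3; v4; v5]) :
  uniq (u :: w :: s) -> cycle e s -> ~~ e w v3 -> ~~ e w v5 ->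
  has_cycle_of_length e 4.
Proof.
rewrite {}/s => U /= /and5P[e12 e23 e34 e45 /andP[e51 _]] w3 w5.
nonchord_tac U v1 v3 [:: v1; v3; v4; v5] n13.
nonchord_tac U v2 v5 [:: v2; v3; v4; v5] n25.
nonchord_tac U v3 v5 [:: v1; v2; v3; v5] n35.
nbrs_tac U v3 w v5 v1 e1w e15'.
nbrs_tac U v5 w v3 v2 e2w e23'.
have [uw|uw] := boolP (e u w); last first.
  nbrs_tac U w v3 v5 u u3 u5.
  by cycle_tac U [:: u; v3; v4; v5].
nonchord_tac U u v5 [:: u; w; v1; v5] u5.
nbrs_tac U v5 w v3 u uw' u3.
by cycle_tac U [:: u; w; v2; v3].
Qed.

Ltac c5_tac U u w a b c d f :=
  apply: (@cycle5_nonnbrs u w a b c d f); [uniq_tac U|edges_tac|by []|by []].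

(** Two neighbours of [w] at distance 2 give a 4-cycle. Otherwise [w] misses two vertices at
    distance 2, which a rotation moves to positions 3 and 5. *)
Lemma cycle5_shorten u w v1 v2 v3 v4 v5 (s := [:: v1; v2; v3; v4; v5]) :
  uniq (u :: w :: s) -> cycle e s -> has_cycle_of_length e 4.
Proof.
rewrite {}/s => U /= /and5P[e12 e23 e34 e45 /andP[e51 _]].
have [w1|w1] := boolP (e w v1).
  nonchord_tac U w v3 [:: w; v1; v2; v3] w3.
  nonchord_tac U w v4 [:: w; v1; v5; v4] w4.
  have [w5|w5] := boolP (e w v5); last by c5_tac U u w v1 v2 v3 v4 v5.
  nonchord_tac U w v2 [:: w; v5; v1; v2] w2.
  by c5_tac U u w v5 v1 v2 v3 v4.
have [w3|w3] := boolP (e w v3); last by c5_tac U u w v4 v5 v1 v2 v3.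
nonchord_tac U w v5 [:: w; v3; v4; v5] w5.
have [w4|w4] := boolP (e w v4); last by c5_tac U u w v2 v3 v4 v5 v1.
nonchord_tac U w v2 [:: w; v4; v3; v2] w2.
by c5_tac U u w v3 v4 v5 v1 v2.
Qed.

(** Without triangles each outside vertex misses a whole diagonal pair. Two of the three miss the
    same pair, and these four vertices span at most one edge. *)
Lemma cycle4_shorten w1 w2 w3 v1 v2 v3 v4 (s := [:: v1; v2; v3; v4]) :
  uniq (w1 :: w2 :: w3 :: s) -> cycle e s -> has_cycle_of_length e 3.
Proof.
rewrite {}/s => U /= /and5P[e12 e23 e34 e41 _].
nonchord_tac U v1 v3 [:: v1; v2; v3] n13.
nonchord_tac U v2 v4 [:: v2; v3; v4] n24.
have side w : uniq [:: w; v1; v2; v3; v4] ->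
    has_cycle_of_length e 3 \/
    ~~ e w v1 && ~~ e w v3 \/ ~~ e w v2 && ~~ e w v4.
  move=> Uw; rewrite -!negb_or.
  have [a13|] := boolP (e w v1 || e w v3); last by right; left.
  have [a24|] := boolP (e w v2 || e w v4); last by right; right.
  left; case/orP: a13 => [w1'|w3']; case/orP: a24 => [w2'|w4'].
  - by cycle_tac Uw [:: w; v1; v2].
  - by cycle_tac Uw [:: w; v4; v1].
  - by cycle_tac Uw [:: w; v2; v3].
  - by cycle_tac Uw [:: w; v3; v4].
have no13 w w' : uniq [:: w; w'; v1; v2; v3; v4] ->
    ~~ e w v1 && ~~ e w v3 -> ~~ e w' v1 && ~~ e w' v3 -> False.
  move=> Uw /andP[a1 a3] /andP[b1 b3].
  by nbrs_tac Uw v1 v3 w w' b3' bw; rewrite b3' in b3.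
have no24 w w' : uniq [:: w; w'; v1; v2; v3; v4] ->
    ~~ e w v2 && ~~ e w v4 -> ~~ e w' v2 && ~~ e w' v4 -> False.
  move=> Uw /andP[a1 a3] /andP[b1 b3].
  by nbrs_tac Uw v2 v4 w w' b3' bw; rewrite b3' in b3.
have U12 : uniq [:: w1; w2; v1; v2; v3; v4] by uniq_tac U.
have U13 : uniq [:: w1; w3; v1; v2; v3; v4] by uniq_tac U.
have U23 : uniq [:: w2; w3; v1; v2; v3; v4] by uniq_tac U.
have [//|s1] := side w1 ltac:(uniq_tac U).
have [//|s2] := side w2 ltac:(uniq_tac U).
have [//|s3] := side w3 ltac:(uniq_tac U).
by exfalso; case: s1 s2 s3 => s1 [] s2 [] s3; eauto.
Qed.

(** * Descent from length [k.+1] to [k] *)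

Lemma fresh_vertex (s : seq T) :
  uniq s -> size s < #|T| -> exists x, uniq (x :: s).
Proof.
move=> Us lts; have [x xs] : exists x, x \notin s.
  apply/existsP; apply: contraTT lts; rewrite negb_exists -leqNgt => /forallP sT.
  rewrite -(card_uniqP Us); apply/subset_leq_card/subsetP => x _.
  by have:= sT x; rewrite negbK.
by exists x; rewrite /= xs.
Qed.

Lemma cycle_shorten k : 7 <= #|T| -> 3 <= k < #|T| ->
  has_cycle_of_length e k.+1 -> has_cycle_of_length e k.
Proof.
move=> T7 /andP[k3 kT] [s [sz U cs]].
have [k6|] := leqP 6 k.
  case: s => [|v1 [|v2 [|v3 [|v4 [|v5 [|v6 [|v7 R]]]]]]] in sz U cs *;
    try by move: k6 sz => /=; lia.
  have short u1 u2 u3 u4 u5 R' (s := [:: u1, u2, u3, u4, u5 & R']) :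
      size s = k.+1 -> uniq s -> cycle e s -> ~~ e u1 u5 -> has_cycle_of_length e k.
    rewrite {}/s => szs Us cs' n15.
    have [k7|k7] := leqP 7 k; first exact: cycle_nonchord5 szs Us cs' k7 n15.
    have k6' : k = 6 by lia.
    case: R' => [|u6 [|u7 [|u8 R']]] in szs Us cs' *;
      try by move: k7 szs => /=; lia.
    by rewrite k6'; apply: cycle7_nonchord5 Us cs' n15.
  have [e15|n15] := boolP (e v1 v5); last exact: short sz U cs n15.
  have [e26|n26] := boolP (e v2 v6); last first.
    apply: (short v2 v3 v4 v5 v6 (v7 :: R ++ [:: v1])); last exact: n26.
    - by move: sz; size_tac.
    - by uniq_tac U.
    - by move: cs; rewrite -(rot_cycle 1).
  have [e37|n37] := boolP (e v3 v7); last first.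
    apply: (short v3 v4 v5 v6 v7 (R ++ [:: v1; v2])); last exact: n37.
    - by move: sz; size_tac.
    - by uniq_tac U.
    - by move: cs; rewrite -(rot_cycle 2).
  exact: cycle_minus_fourth sz U cs e15 e26 e37.
(* The cycle has [k.+1] vertices, so at least one, two or three lie outside it for [k] equal to 5, 4
   or 3. *)
move=> k6; have [x1 U1] := fresh_vertex U ltac:(rewrite sz; lia).
have [k5|k5] := leqP 5 k.
  have k5' : k = 5 by lia.
  case: s => [|v1 [|v2 [|v3 [|v4 [|v5 [|v6 [|v7 R]]]]]]] in sz U cs U1 *;
    try by move: k6 sz => /=; lia.
  by rewrite k5'; apply: cycle6_shorten U1 cs.
have [x2 U2] := fresh_vertex U1 ltac:(apply: leq_trans T7; rewrite /= sz; lia).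
have [k4|k4] := leqP 4 k.
  have k4' : k = 4 by lia.
  case: s => [|v1 [|v2 [|v3 [|v4 [|v5 [|v6 R]]]]]] in sz U cs U1 U2 *;
    try by move: k5 sz => /=; lia.
  by rewrite k4'; apply: cycle5_shorten U2 cs.
have [x3 U3] := fresh_vertex U2 ltac:(apply: leq_trans T7; rewrite /= sz; lia).
have k3' : k = 3 by lia.
case: s => [|v1 [|v2 [|v3 [|v4 [|v5 R]]]]] in sz U cs U1 U2 U3 *;
  try by move: k4 sz => /=; lia.
by rewrite k3'; apply: cycle4_shorten U3 cs.
Qed.

(** * Longest cycles with an ear *)

(* u A v B is a longest cycle (read cyclically) and P the interior of an ear
   from u to v. *)
Definition max_cycle_ear u A v B P :=
  [/\ uniq (u :: A ++ v :: B ++ P), path e u (rcons A v), path e v (rcons B u)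
    & path e u (rcons P v)] /\
  [/\ P != [::] & forall L, uniq L -> cycle e L -> size L <= (size A + size B).+2].

(** This symmetry carries every statement about [A] over to [B]. *)
Lemma max_cycle_earC u A v B P :
  max_cycle_ear u A v B P -> max_cycle_ear v B u A (rev P).
Proof.
case=> -[U lA lB lP] [nP mx]; split; split=> //.
- by uniq_tac U.
- by rewrite link_rev.
- by rewrite -size_eq0 size_rev size_eq0.
- by move=> L UL cL; rewrite addnC mx.
Qed.

Lemma max_cycle_ear_contra S L u A v B P :
  max_cycle_ear u A v B P -> uniq S -> cycle e L ->
  (forall q : pred T, count q L <= count q S) ->
  (size A + size B).+2 < size L -> False.
Proof.
move=> [_ [_ mx]] US cL le; rewrite ltnNge mx //; exact: leq_count_uniq US.
Qed.

Ltac links_tac :=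
  rewrite /= ?(link_cat, link_rev) /= ?(link_cat, link_rev) /= ?(link_cat, link_rev) /=
    ?(link_cat, link_rev) /= ?andbT;
  repeat (apply/andP; split); by [|rewrite esym].
Ltac longer_tac E U L :=
  exfalso; apply: (max_cycle_ear_contra (L := L) E U); [links_tac|count_tac|size_tac].

(** If [u] and [v] were consecutive, the ear could replace the edge between them. *)
Lemma max_cycle_ear_cons u A v B P : max_cycle_ear u A v B P ->
  exists a A', A = a :: A'.
Proof.
case: A => [|a A] E; last by exists a, A.
have [[U lA lB lP] [nP _]] := E.
case: P => [|p P] // in E U lP nP *.
move: lP => /= /andP[up lP]; by longer_tac E U (u :: p :: P ++ v :: B).
Qed.

(** An edge [p a] or [p c] inserts part of the ear after [u] or [v]. An edge [a c] admits the whole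
    ear, with [A] run backwards from [v]. *)
Lemma max_cycle_ear_indep u a A v c B P p :
  max_cycle_ear u (a :: A) v (c :: B) P -> p \in P ->
  [/\ ~~ e p a, ~~ e p c & ~~ e a c].
Proof.
move=> E pP; have [[U /= /andP[ua lA] /andP[vc lB] lP] _] := E.
have [P1 [P2 defP]] := mem_split pP; move: lP.
rewrite defP link_cat in E U * => /andP[lP1 lP2].
split; apply/negP=> adj.
- by longer_tac E U (u :: P1 ++ p :: a :: A ++ v :: c :: B).
- by longer_tac E U (u :: a :: A ++ v :: rev P2 ++ p :: c :: B).
- by longer_tac E U (u :: P1 ++ p :: P2 ++ v :: rev A ++ a :: c :: B).
Qed.

(** A second ear vertex would miss both [a] and [c] of the independent triple [a], [b], [c]. A
    vertex [d] off cycle and ear is adjacent to two of the triple, and each pair gives a longer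
    cycle. *)
Lemma max_cycle_ear_single u a A v c B P :
  max_cycle_ear u (a :: A) v (c :: B) P ->
  exists2 b, P = [:: b] & #|T| = (size A + size B + 5)%N.
Proof.
move=> E; have [[U /= /andP[ua lA] /andP[vc lB] lP] [nP _]] := E.
case: P nP => [|b [|p P]] // _ in E U lP *; last first.
  have [ba bc ac] := max_cycle_ear_indep E (mem_head b _).
  have [|pa pc _] := @max_cycle_ear_indep _ _ _ _ _ _ _ p E.
    by rewrite !inE eqxx orbT.
  nbrs_tac U a b c p pb pc'.
  by rewrite pc' in pc.
exists b => //; have [ba bc ac] := max_cycle_ear_indep E (mem_head b _).
move: lP => /= /and3P[ub bv _].
have [leT|gtT] := leqP #|T| (size (u :: (a :: A) ++ v :: (c :: B) ++ [:: b])).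
  have geT := max_card (mem (u :: (a :: A) ++ v :: (c :: B) ++ [:: b])).
  rewrite (card_uniqP U) in geT; apply/eqP; rewrite eqn_leq.
  apply/andP; split; [apply: leq_trans leT _ | apply: leq_trans geT]; size_tac.
have [d Ud] := fresh_vertex U gtT.
have [da|da] := boolP (e d a); last first.
  nbrs_tac Ud a b c d db dc.
  by longer_tac E Ud (u :: a :: A ++ v :: b :: d :: c :: B).
have [db|db] := boolP (e d b).
  by longer_tac E Ud (u :: b :: d :: a :: A ++ v :: c :: B).
nbrs_tac Ud b a c d da' dc.
by longer_tac E Ud (u :: b :: v :: rev A ++ a :: d :: c :: B).
Qed.

Lemma max_cycle_ear_inner u a A v c B b x :
  max_cycle_ear u (a :: A) v (c :: B) [:: b] -> x \in A -> e x a && e x c.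
Proof.
move=> E xA; have [[U /= /andP[ua lA] /andP[vc lB] /and3P[ub bv _]] _] := E.
have [ba bc ac] := max_cycle_ear_indep E (mem_head b _).
have [A1 [A2 defA]] := mem_split xA; rewrite {xA}defA in E U lA *.
move: lA; rewrite link_cat => /andP[lA1 lA2].
have [xb|xb] := boolP (e x b); last by nbrs_tac U b a c x xa xc; rewrite xa.
(* [b] fits between [x] and its successor unless that is some [y] not adjacent to [b]; then [y] is
   adjacent to [a], and the stretch from [a] to [x] is reversed. *)
exfalso; case: A2 => [|y A2] in E U lA2 *.
  by longer_tac E U (u :: a :: A1 ++ x :: b :: v :: c :: B).
move: lA2 => /= /andP[xy lA2].
have [yb|yb] := boolP (e y b).
  by longer_tac E U (u :: a :: A1 ++ x :: b :: y :: A2 ++ v :: c :: B).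
nbrs_tac U b a c y ya yc.
by longer_tac E U (u :: b :: x :: rev A1 ++ a :: y :: A2 ++ v :: c :: B).
Qed.

Lemma max_cycle_ear_short u a A v c B b :
  max_cycle_ear u (a :: A) v (c :: B) [:: b] -> size A <= 1.
Proof.
move=> E; have [[U /= /andP[ua lA] /andP[vc lB] /and3P[ub bv _]] _] := E.
case: A => [|x [|x' A]] // in E U lA *.
have /andP[xa xc] := max_cycle_ear_inner E (mem_head x _).
have /andP[xa' xc'] : e x' a && e x' c.
  by apply: max_cycle_ear_inner E _; rewrite !inE eqxx orbT.
move: lA => /= /and3P[ax xx' lA].
(* The chords [x' a] and [x c] allow a backward run from [v] that still collects [a] and [x]. *)
by longer_tac E U (u :: b :: v :: rev A ++ x' :: a :: x :: c :: B).
Qed.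

Lemma no_max_cycle_ear u A v B P :
  7 <= #|T| -> max_cycle_ear u A v B P -> False.
Proof.
move=> T7 E; have [c [B' defB]] := max_cycle_ear_cons (max_cycle_earC E).
have [a [A' defA]] := max_cycle_ear_cons E; rewrite {}defA {}defB in E.
have [b defP cardT] := max_cycle_ear_single E; rewrite {}defP in E.
have EC := max_cycle_earC E.
have := max_cycle_ear_short E; have := max_cycle_ear_short EC.
rewrite {}cardT in T7.
(* At least 7 vertices leave only the case of one vertex in each of [A'] and [B']. *)
case: A' B' => [|x [|? ?]] [|y [|? ?]] // in E EC T7 *; rewrite ?ltnn // => _ _.
have [[U /= /and4P[ua ax xv _] /and3P[vc cy _] /and3P[ub bv _]] _] := E.
have /andP[xa xc] := max_cycle_ear_inner E (mem_head x _).
have /andP[yc ya] := max_cycle_ear_inner EC (mem_head y _).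
by longer_tac E U [:: u; b; v; x; c; y; a].
Qed.

(** * Ears from 2-connectivity, and Hamiltonicity *)

(** Some edge [u b] leaves [S]. With [u] deleted, a simple path from [b] to another vertex of [S],
    cut at its first vertex in [S], completes the ear. *)
Lemma ear_exists (S : pred T) x0 y0 z0 : two_connected e ->
  S x0 -> S y0 -> x0 != y0 -> ~~ S z0 ->
  exists u v P, [/\ S u, S v, u != v & [/\ P != [::], uniq P,
     path e u (rcons P v) & all (predC S) P]].
Proof.
move=> [_ [con con2]] Sx0 Sy0 nxy nSz.
have [u [b [Su nSb ub]]] : exists u b, [/\ S u, ~~ S b & e u b].
  case/connectP: (con x0 z0) => p pp defz; rewrite defz in nSz.
  have [||L1 [u [b [L2 [defL Su nSb]]]]] := @first_switch _ (predC S) x0 p; rewrite /= ?Sx0 //.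
  rewrite negbK in Su; exists u, b; split=> //.
  case: L1 defL => [[? ?]|y L1 [? defp]]; subst.
    by case/andP: pp.
  by move: pp; rewrite cat_path /= => /and4P[].
have [w Sw nwu] : exists2 w, S w & w != u.
  have [eq|ne] := eqVneq x0 u; last by exists x0.
  by exists y0 => //; rewrite -eq eq_sym.
have nbu : b != u by apply: contraNneq nSb => ->.
case/connectP: (con2 u b w nbu nwu) => p0 /shortenP[p pp Up _] defw.
have [v [P1 [P2 [defp Sv nSP]]]] : exists v P1 P2,
    [/\ p = P1 ++ v :: P2, S v & all (predC S) P1].
  have hasS : has S p.
    rewrite defw in Sw; case: (lastP p) Sw => [|q y] /=; first by rewrite (negPf nSb).
    by rewrite last_rcons has_rcons => ->.
  case/split_find: hasS => v P1 P2 Sv; rewrite -all_predC => aP.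
  by exists v, P1, P2; rewrite cat_rcons.
exists u, v, (b :: P1); rewrite defp in pp Up *; split=> //.
  by move: pp; rewrite cat_path /= => /and3P[_ /andP[_]]; rewrite eq_sym.
split=> //; [by uniq_tac Up| |by rewrite /= nSb].
rewrite /= ub rcons_path; move: pp; rewrite cat_path /= => /and3P[pP1].
move=> /andP[/andP[-> _] _] _; rewrite andbT.
by apply: sub_path pP1 => x y /= /andP[/andP[]].
Qed.

Lemma hamiltonian : 7 <= #|T| -> two_connected e -> has_cycle_of_length e #|T|.
Proof.
move=> T7 con2.
pose cyc k := [exists t : k.-tuple T, uniq t && cycle e t].
have cycP L : uniq L -> cycle e L -> cyc (size L).
  by move=> UL cL; apply/existsP; exists (in_tuple L); rewrite UL.
have bound k : cyc k -> k <= #|T|.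
  case/existsP=> t /andP[/card_uniqP Ut _].
  by rewrite -[k in k <= _](size_tuple t) -Ut max_card.
have [x [y xy]] : exists x y, e x y.
  have [[z [w nzw]] con] : (exists z w : T, z != w) /\ connected_graph e.
    have [T2 [con _]] := con2; split=> //.
    by have /card_gt1P[z [w [_ _ nzw]]] := ltnW T2; exists z, w.
  case/connectP: (con z w) => [[|y p]] /=; first by move=> _ eq; rewrite eq eqxx in nzw.
  by case/andP=> zy _ _; exists z, y.
(* An edge run back and forth counts as a cycle of length 2, so a maximal length exists and provides
   two distinct vertices for the ear. *)
have cyc2 : cyc 2.
  by apply: (cycP [:: x; y]); rewrite /= ?inE ?(e_neq xy) // xy esym xy.
have [m /existsP[t /andP[Ut ct]] mx] := ex_maxnP (ex_intro _ 2 cyc2) bound.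
have m2 := mx _ cyc2.
have [leTm|ltmT] := leqP #|T| m.
  exists t; split=> //; apply/eqP.
  by rewrite size_tuple eqn_leq leTm bound //; rewrite -(size_tuple t) cycP.
have {x y xy cyc2}[x [y [xt yt nxy]]] : exists x y, [/\ x \in t, y \in t & x != y].
  case defs: (tval t) Ut (size_tuple t) => [|a [|c s]] Us sz;
    try by rewrite -sz in m2.
  exists a, c; split; rewrite -?[_ \in t]/(_ \in tval t) ?defs ?inE ?eqxx ?orbT //.
  by move: Us => /= /andP[]; rewrite inE negb_or => /andP[].
have [z /= /andP[zt _]] : exists z, uniq (z :: t).
  by apply: fresh_vertex; rewrite ?size_tuple.
have [u [v [P [ut vt nuv [nP UP lP aP]]]]] := @ear_exists (mem t) x y z con2 xt yt nxy zt.
have [i L defL] := rot_to ut.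
have vL : v \in L.
  by have: v \in rot i t; [rewrite mem_rot | rewrite defL inE eq_sym (negPf nuv)].
have [A [B defAB]] := mem_split vL; rewrite {}defAB in defL vL.
exfalso; apply: (@no_max_cycle_ear u A v B P) => //; split; split=> //.
- have -> : u :: A ++ v :: B ++ P = rot i t ++ P by rewrite defL /= -catA.
  rewrite cat_uniq rot_uniq Ut UP /= andbT -all_predC.
  by apply: sub_all aP => p /=; rewrite mem_rot.
- by move: ct; rewrite -(rot_cycle i) defL /= link_cat => /andP[].
- by move: ct; rewrite -(rot_cycle i) defL /= link_cat => /andP[].
move=> K UK cK; suff <- : m = (size A + size B).+2 by rewrite mx ?cycP.
by rewrite -(size_tuple t) -(size_rot i) defL /= size_cat /= addnS.
Qed.

End Graph.

Theorem theorem6 (T : finType) (e : rel T) :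
  simple_graph e -> 7 <= #|T| ->
  two_connected e -> st_graph e 4 2 ->
  pancyclic e.
Proof.
move=> [esym eirr] T7 con2 st k /andP[k3 kT].
(* Induction on the number of vertices dropped from a Hamiltonian cycle; the bound keeps the length
   at least 3. *)
rewrite -(subKn kT); have: #|T| - k <= #|T| - 3 by rewrite leq_sub2l.
elim: (#|T| - k) => [|i IH] lei; first by rewrite subn0; apply: hamiltonian.
apply: cycle_shorten => //; first by lia.
by rewrite subnSK; [apply: IH; lia | lia].
Qed.
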